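(* The functors $F$ and $U$ induce inverse equivalences of categories between the full subcategories of projective $H$-modules (in $\mathrm{Mod}(H)$) and of $I$-projective $G$-representations (in $\mathrm{Rep}^\infty_k(G)$), respectively.
   Context: Let $k$ be a field of characteristic $p>0$ and $G$ a topological group (possibly discrete) admitting an open pro-$p$ subgroup $I$. $\mathrm{Rep}_k^\infty(G)$ is the category of smooth $k$-linear $G$-representations (stabilizers of vectors are open). $\mathbb{X}=\mathrm{ind}_I^G(k)$ is the space of compactly supported $f:G\to k$ with $f(gi)=f(g)$ for $i\in I$, with action $(gf)(g')=f(g^{-1}g')$; $H=\mathrm{End}_G(\mathbb{X})^{\mathrm{op}}$; $\mathrm{Mod}(H)$ is the category of left $H$-modules. There is an adjunction $F:\mathrm{Mod}(H)\rightleftarrows\mathrm{Rep}^\infty_k(G):U$ ($F$ left adjoint), $FM=\mathbb{X}\otimes_HM$, $UV=V^I\cong\mathrm{Hom}_G(\mathbb{X},V)$. A representation $V\in\mathrm{Rep}^\infty_k(G)$ is $I$-projective if there is a split surjection $FP\to V$ for some projective $H$-module $P$. *)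

(* Defs.v *)
From HB Require Import structures.
From mathcomp Require Import all_boot all_order all_algebra.
From mathcomp Require Import all_classical.
From mathcomp Require Import topology.

Set Implicit Arguments.
Unset Strict Implicit.
Unset Printing Implicit Defensive.

Import GRing.Theory.
Local Open Scope classical_set_scope.
Local Open Scope quotient_scope.
Local Open Scope ring_scope.

Record category := Category {
  obj :> Type;
  hom : obj -> obj -> Type;
  idc : forall a, hom a a;
  compc : forall a b c, hom b c -> hom a b -> hom a c;
  comp1c : forall a b (f : hom a b), compc (idc b) f = f;
  compc1 : forall a b (f : hom a b), compc f (idc a) = f;
  compA : forall a b c d (h : hom c d) (g : hom b c) (f : hom a b),
    compc h (compc g f) = compc (compc h g) f }.

Definition is_iso (C : category) (a b : C) (f : hom a b) : Prop :=
  exists g : hom b a, compc g f = idc a /\ compc f g = idc b.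

Definition split_epi (C : category) (a b : C) (f : hom a b) : Prop :=
  exists s : hom b a, compc f s = idc b.

Record functor (C D : category) := Functor {
  fobj :> C -> D;
  fmap : forall a b, hom a b -> hom (fobj a) (fobj b);
  fmap1 : forall a, fmap (idc a) = idc (fobj a);
  fmap_comp : forall a b c (g : hom b c) (f : hom a b),
    fmap (compc g f) = compc (fmap g) (fmap f) }.

Definition id_functor (C : category) : functor C C :=
  @Functor C C id (fun _ _ f => f) (fun _ => erefl) (fun _ _ _ _ _ => erefl).

Section CompFunctor.
Variables (C D E : category) (K : functor D E) (L : functor C D).

Fact comp_functor1 (a : C) : fmap K (fmap L (idc a)) = idc (K (L a)).
Proof. by rewrite !fmap1. Qed.

Fact comp_functorM (a b c : C) (g : hom b c) (f : hom a b) :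
  fmap K (fmap L (compc g f)) = compc (fmap K (fmap L g)) (fmap K (fmap L f)).
Proof. by rewrite !fmap_comp. Qed.

Definition comp_functor : functor C E :=
  @Functor C E (fun a => K (L a)) (fun _ _ f => fmap K (fmap L f))
    comp_functor1 comp_functorM.
End CompFunctor.

Definition nat_iso (C D : category) (K L : functor C D) : Prop :=
  exists a : forall x : C, hom (K x) (L x),
    (forall x, is_iso (a x)) /\
    (forall (x y : C) (f : hom x y),
       compc (a y) (fmap K f) = compc (fmap L f) (a x)).

Definition inverse_equivalences (C D : category)
    (K : functor C D) (L : functor D C) : Prop :=
  nat_iso (comp_functor L K) (id_functor C) /\
  nat_iso (comp_functor K L) (id_functor D).

Definition full_subcategory (C : category) (P : C -> Prop) : category :=
  @Category {x : C | P x} (fun x y => hom (sval x) (sval y))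
    (fun x => idc (sval x)) (fun _ _ _ g f => compc g f)
    (fun _ _ f => comp1c f) (fun _ _ f => compc1 f)
    (fun _ _ _ _ h g f => compA h g f).

Definition restrict_functor (C D : category) (P : C -> Prop) (Q : D -> Prop)
    (K : functor C D) (KPQ : forall x, P x -> Q (K x)) :
    functor (full_subcategory P) (full_subcategory Q) :=
  @Functor (full_subcategory P) (full_subcategory Q)
    (fun x => exist Q (K (sval x)) (KPQ (sval x) (svalP x)))
    (fun _ _ f => fmap K f) (fun x => fmap1 K (sval x))
    (fun _ _ _ g f => fmap_comp K g f).

HB.mixin Record Group_Topological_isTopGroup G of Group G & Topological G := {
  mulg_continuous : continuous (fun x : G * G => (x.1 * x.2)%g);
  invg_continuous : continuous (fun x : G => x^-1%g) }.

#[short(type="topGroupType")]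
HB.structure Definition TopGroup :=
  {G of Group G & Topological G & Group_Topological_isTopGroup G}.

Section Subgroups.
Variable G : topGroupType.

Definition subgroup (H : set G) : Prop :=
  [/\ H 1%g, forall x y, H x -> H y -> H (x * y)%g
    & forall x, H x -> H x^-1%g].

Definition lcosets (H K : set G) : set (set G) :=
  [set [set (g * x)%g | x in K] | g in H].

(* [subspace H] is [G] with the relative topology on [H], every point outside
   [H] being made isolated *)
Definition profinite_subgroup (H : set G) : Prop :=
  [/\ subgroup H, compact H, hausdorff_space (subspace H)
    & totally_disconnected H].

Definition pro_p_subgroup (p : nat) (H : set G) : Prop :=
  profinite_subgroup H /\
  forall N : set G, subgroup N -> N `<=` H ->
    (forall h x, H h -> N x -> N (h^-1 * x * h)%g) ->
    open (N : set (subspace H)) ->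
    exists n : nat, (lcosets H N #= `I_(p ^ n))%card.

Record open_pro_p_subgroup (p : nat) := OpenProP {
  opp_set : set G;
  opp_open : open opp_set;
  opp_pro_p : pro_p_subgroup p opp_set }.

Lemma lmulg_continuous (g : G) : continuous (fun x : G => (g * x)%g).
Proof.
move=> x; apply: (@continuous2_cvg G G G G (nbhs x) _ (fun _ => g) id
  (fun a b => (a * b)%g) g x); last 2 first.
- exact: cvg_cst.
- exact: cvg_id.
exact: (mulg_continuous (g, x)).
Qed.

Lemma rmulg_continuous (g : G) : continuous (fun x : G => (x * g)%g).
Proof.
move=> x; apply: (@continuous2_cvg G G G G (nbhs x) _ id (fun _ => g)
  (fun a b => (a * b)%g) x g); last 2 first.
- exact: cvg_id.
- exact: cvg_cst.
exact: (mulg_continuous (x, g)).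
Qed.

Lemma open_lmulg (g : G) (A : set G) : open A -> open [set x | A (g * x)%g].
Proof. by move=> oA; apply: open_comp => // x _; apply: lmulg_continuous. Qed.

Lemma open_rmulg (g : G) (A : set G) : open A -> open [set x | A (x * g)%g].
Proof. by move=> oA; apply: open_comp => // x _; apply: rmulg_continuous. Qed.

Lemma subgroup_open (H U : set G) :
  subgroup H -> open U -> U 1%g -> U `<=` H -> open H.
Proof.
move=> [H1 HM HV] oU U1 UH.
have -> : H = \bigcup_(h in H) [set x | U (h^-1 * x)%g].
  apply/seteqP; split=> x; first by exists x => //=; rewrite mulVg.
  by move=> [h Hh /= /UH /(HM _ _ Hh)]; rewrite mulgA mulgV mul1g.
by apply: bigcup_open => h _; apply: open_lmulg.
Qed.
End Subgroups.

Section Modules.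
Variable R : pzRingType.

Lemma linear_ext (M N : lmodType R) (f g : {linear M -> N}) : f =1 g -> f = g.
Proof.
case: f g => [f [[[f1 f2]] [f3]]] [g [[[g1 g2]] [g3]]] /= /funext fg.
move: f1 f2 f3 g1 g2 g3; rewrite fg => f1 f2 f3 g1 g2 g3.
by rewrite (Prop_irrelevance f1 g1) (Prop_irrelevance f2 g2)
           (Prop_irrelevance f3 g3).
Qed.

Definition Mod : category.
Proof.
refine (@Category (lmodType R) (fun M N => {linear M -> N})
  (fun M => idfun : {linear M -> M}) (fun _ _ _ g f => g \o f : {linear _ -> _})
  _ _ _).
- by move=> M N f; apply: linear_ext.
- by move=> M N f; apply: linear_ext.
- by move=> M N O P h g f; apply: linear_ext.
Defined.

Definition projective_module (P : lmodType R) : Prop :=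
  forall (M N : lmodType R) (f : {linear M -> N}) (g : {linear P -> N}),
    (forall y, exists x, f x = y) ->
    exists h : {linear P -> M}, forall x, f (h x) = g x.

(* [A] is to be thought of as a right [R]-module, with action [ract]. *)
Section Tensor.
Variables (A : zmodType) (ract : A -> R -> A) (M : lmodType R).

(* A list [:: (a1, m1); ...; (an, mn)] stands for the formal sum
   a1 ⊗ m1 + ... + an ⊗ mn; the quotient of the monoid of formal sums by this
   congruence is already a group, since (a, m) + (- a, m) = (0, m) = 0. *)
Inductive tensor_rel : seq (A * M) -> seq (A * M) -> Prop :=
| TensorRefl s : tensor_rel s s
| TensorSym s t : tensor_rel s t -> tensor_rel t s
| TensorTrans s t u : tensor_rel s t -> tensor_rel t u -> tensor_rel s u
| TensorCat s s' t t' : tensor_rel s s' -> tensor_rel t t' ->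
    tensor_rel (s ++ t) (s' ++ t')
| TensorC s t : tensor_rel (s ++ t) (t ++ s)
| Tensor0 m : tensor_rel [:: (0, m)] [::]
| TensorDl a b m : tensor_rel [:: (a + b, m)] [:: (a, m); (b, m)]
| TensorDr a m n : tensor_rel [:: (a, m + n)] [:: (a, m); (a, n)]
| TensorBal a r m : tensor_rel [:: (ract a r, m)] [:: (a, r *: m)].

Definition tensor_relb : rel (seq (A * M)) := fun s t => `[< tensor_rel s t >].

Fact tensor_relb_equiv : equiv_class_of tensor_relb.
Proof.
split=> [s|s t|t s u].
- exact/asboolP/TensorRefl.
- by apply/asboolP/asboolP => ?; exact: TensorSym.
- by move=> /asboolP st /asboolP tu; apply/asboolP/(TensorTrans st tu).
Qed.

Canonical tensor_equiv := EquivRelPack tensor_relb_equiv.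

Definition tensor := {eq_quot tensor_equiv}.
HB.instance Definition _ := Choice.on tensor.
HB.instance Definition _ := EqQuotient.on tensor.

Definition tclass (s : seq (A * M)) : tensor := \pi_tensor s.

Lemma tclassP s t : tclass s = tclass t <-> tensor_rel s t.
Proof.
split; first by move/eqmodP/asboolP.
by move=> st; apply/eqmodP/asboolP.
Qed.

Lemma tclass_repr (t : tensor) : tclass (repr t) = t.
Proof. exact: reprK. Qed.

Lemma repr_tclass s : tensor_rel (repr (tclass s)) s.
Proof. by apply/tclassP; rewrite tclass_repr. Qed.

Definition tadd (x y : tensor) : tensor := tclass (repr x ++ repr y).
Definition topp (x : tensor) : tensor :=
  tclass [seq (- z.1, z.2) | z <- repr x].

Lemma tadd_class s t : tadd (tclass s) (tclass t) = tclass (s ++ t).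
Proof. by apply/tclassP/TensorCat; apply: repr_tclass. Qed.

Fact taddA : associative tadd.
Proof.
move=> x y z; rewrite -(tclass_repr x) -(tclass_repr y) -(tclass_repr z).
by rewrite !tadd_class catA.
Qed.

Fact taddC : commutative tadd.
Proof. by move=> x y; apply/tclassP/TensorC. Qed.

Fact tadd0 : left_id (tclass [::]) tadd.
Proof. by move=> x; rewrite -(tclass_repr x) tadd_class. Qed.

Fact taddN : left_inverse (tclass [::]) topp tadd.
Proof.
move=> x; rewrite /topp -{2}(tclass_repr x) tadd_class.
elim: (repr x) => [//|[a m] s IHs]; set u : A * M := (- a, m); set v := (a, m).
have -> : [seq (- z.1, z.2) | z <- v :: s] ++ v :: s =
    [:: u] ++ ([seq (- z.1, z.2) | z <- s] ++ ([:: v] ++ s)) by [].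
rewrite -!tadd_class [tadd _ (tadd _ (tclass s))]taddA.
rewrite [tadd _ (tclass [:: v])]taddC -[tadd _ (tclass s)]taddA.
rewrite [tadd _ (tclass s)]tadd_class IHs [tadd _ (tclass [::])]taddC tadd0.
rewrite tadd_class; apply/tclassP/TensorTrans/(Tensor0 m); rewrite -(addNr a).
exact/TensorSym/TensorDl.
Qed.

HB.instance Definition _ := GRing.isZmodule.Build tensor taddA taddC tadd0 taddN.

Definition pure (a : A) (m : M) : tensor := tclass [:: (a, m)].

Lemma tclass_sum s : tclass s = \sum_(z <- s) pure z.1 z.2.
Proof.
elim: s => [|[a m] s IHs]; first by rewrite big_nil.
by rewrite big_cons -IHs /pure [RHS]tadd_class.
Qed.

Lemma tensor_ind (P : tensor -> Prop) :
  P 0 -> (forall a m t, P t -> P (pure a m + t)) -> forall t, P t.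
Proof.
move=> P0 PD t; rewrite -(tclass_repr t) tclass_sum.
by elim: (repr t) => [|z s IHs]; rewrite ?big_nil// big_cons; apply: PD.
Qed.

Lemma pureDl a b m : pure (a + b) m = pure a m + pure b m.
Proof. by rewrite [RHS]tadd_class; apply/tclassP/TensorDl. Qed.

Lemma pureDr a m n : pure a (m + n) = pure a m + pure a n.
Proof. by rewrite [RHS]tadd_class; apply/tclassP/TensorDr. Qed.

Lemma pure_bal a r m : pure (ract a r) m = pure a (r *: m).
Proof. exact/tclassP/TensorBal. Qed.

Lemma pure0l m : pure 0 m = 0.
Proof. exact/tclassP/Tensor0. Qed.

Lemma pure0r a : pure a 0 = 0.
Proof. by apply: (addrI (pure a 0)); rewrite -pureDr !addr0. Qed.

Section Lift.
Variables (B : zmodType) (phi : A -> M -> B).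

Definition balanced : Prop :=
  [/\ forall a b m, phi (a + b) m = phi a m + phi b m,
      forall a m n, phi a (m + n) = phi a m + phi a n
    & forall a r m, phi (ract a r) m = phi a (r *: m)].

Definition tlift (t : tensor) : B := \sum_(z <- repr t) phi z.1 z.2.

Hypothesis phiP : balanced.

Lemma tlift_class s : tlift (tclass s) = \sum_(z <- s) phi z.1 z.2.
Proof.
case: phiP => phiDl phiDr phiB.
rewrite /tlift; have := repr_tclass s; move: (repr _) => t.
elim=> {s t} [||||||||] //=.
- by move=> s t u _ -> _ ->.
- by move=> s s' t t' _ IHs _ IHt; rewrite !big_cat IHs IHt.
- by move=> s t; rewrite !big_cat /= addrC.
- move=> m; rewrite big_seq1 big_nil /=; apply: (addrI (phi 0 m)).
  by rewrite -phiDl !addr0.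
- by move=> a b m; rewrite big_seq1 big_cons big_seq1 phiDl.
- by move=> a m n; rewrite big_seq1 big_cons big_seq1 phiDr.
- by move=> a r m; rewrite !big_seq1 phiB.
Qed.

Lemma tlift_pure a m : tlift (pure a m) = phi a m.
Proof. by rewrite tlift_class big_seq1. Qed.

Lemma tliftD : {morph tlift : s t / s + t}.
Proof. by move=> s t; rewrite [s + t]/(tclass _) tlift_class big_cat. Qed.

Lemma tlift0 : tlift 0 = 0.
Proof. by rewrite tlift_class big_nil. Qed.
End Lift.
End Tensor.

Section TensorMap.
Variables (A A' : zmodType) (ract : A -> R -> A) (ract' : A' -> R -> A').
Variables (M M' : lmodType R) (f : A -> A') (g : M -> M').

Definition tmap : tensor ract M -> tensor ract' M' :=
  tlift (fun a m => pure ract' (f a) (g m)).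

Hypothesis fD : {morph f : a b / a + b}.
Hypothesis fr : forall a r, f (ract a r) = ract' (f a) r.
Hypothesis gl : linear g.

Fact tmap_balanced : balanced ract (fun a m => pure ract' (f a) (g m)).
Proof.
split=> [a b m|a m n|a r m]; first by rewrite fD pureDl.
  by rewrite -[m in g (m + _)]scale1r gl scale1r pureDr.
have g0 : g 0 = 0 by apply: (addrI (g 0)); rewrite -{1}[g 0]scale1r -gl !scale1r !addr0.
by rewrite fr pure_bal -[r *: m]addr0 gl g0 addr0.
Qed.

Lemma tmap_pure a m : tmap (pure ract a m) = pure ract' (f a) (g m).
Proof. exact: (tlift_pure tmap_balanced). Qed.

Lemma tmapD : {morph tmap : s t / s + t}.
Proof. exact: (tliftD tmap_balanced). Qed.

Lemma tmap0 : tmap 0 = 0.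
Proof. exact: (tlift0 tmap_balanced). Qed.
End TensorMap.

End Modules.

Section Representations.
Variables (k : fieldType) (G : topGroupType).

Record smooth_rep := SmoothRep {
  rep_sort :> lmodType k;
  act : G -> rep_sort -> rep_sort;
  act_linear : forall g, linear (act g);
  act1 : forall v, act 1%g v = v;
  actM : forall g h v, act (g * h)%g v = act g (act h v);
  act_smooth : forall v, open [set g | act g v = v] }.

HB.instance Definition _ (V : smooth_rep) (g : G) :=
  GRing.isLinear.Build k V V *:%R (@act V g) (@act_linear V g).

Lemma actK (V : smooth_rep) g : cancel (@act V g) (@act V g^-1%g).
Proof. by move=> v; rewrite -actM mulVg act1. Qed.

Lemma actVK (V : smooth_rep) g : cancel (@act V g^-1%g) (@act V g).
Proof. by move=> v; rewrite -actM mulgV act1. Qed.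

Lemma stabilizer_subgroup (V : smooth_rep) (v : V) :
  subgroup [set g | act g v = v].
Proof.
split=> [|x y /= xv yv|x /= xv]; first by rewrite /= act1.
  by rewrite actM yv xv.
by rewrite -{1}xv actK.
Qed.

Record rep_hom (V W : smooth_rep) := RepHom {
  rep_fun :> V -> W;
  rep_linear : linear rep_fun;
  rep_equivariant : forall g v, rep_fun (act g v) = act g (rep_fun v) }.

HB.instance Definition _ (V W : smooth_rep) (f : rep_hom V W) :=
  GRing.isLinear.Build k V W *:%R f (@rep_linear V W f).

Lemma rep_hom_ext (V W : smooth_rep) (f g : rep_hom V W) : f =1 g -> f = g.
Proof.
case: f g => [f fl fe] [g gl ge] /= /funext fg.
move: fl fe gl ge; rewrite fg => fl fe gl ge.
by rewrite (Prop_irrelevance fl gl) (Prop_irrelevance fe ge).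
Qed.

Definition rep_id (V : smooth_rep) : rep_hom V V :=
  @RepHom V V id (fun _ _ _ => erefl) (fun _ _ => erefl).

Section RepComp.
Variables (U V W : smooth_rep) (g : rep_hom V W) (f : rep_hom U V).
Fact rep_comp_linear : linear (g \o f).
Proof. by move=> a u v; rewrite /= !linearP. Qed.
Fact rep_comp_equivariant h u : (g \o f) (act h u) = act h ((g \o f) u).
Proof. by rewrite /= !rep_equivariant. Qed.
Definition rep_comp := RepHom rep_comp_linear rep_comp_equivariant.
End RepComp.

Definition Rep : category.
Proof.
refine (@Category smooth_rep rep_hom rep_id rep_comp _ _ _).
- by move=> V W f; apply: rep_hom_ext.
- by move=> V W f; apply: rep_hom_ext.
- by move=> U V W X h g f; apply: rep_hom_ext.
Defined.

Section RepHomZmod.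
Variables V W : smooth_rep.
Implicit Types f g : rep_hom V W.

HB.instance Definition _ := gen_eqMixin (rep_hom V W).
HB.instance Definition _ := gen_choiceMixin (rep_hom V W).

Fact rep_zero_linear : linear (fun _ : V => 0 : W).
Proof. by move=> a u v; rewrite scaler0 addr0. Qed.
Fact rep_zero_equivariant h (u : V) : 0 = act h (0 : W).
Proof. by rewrite linear0. Qed.
Definition rep_zero := @RepHom V W _ rep_zero_linear rep_zero_equivariant.

Fact rep_add_linear f g : linear (fun v => f v + g v).
Proof. by move=> a u v; rewrite !linearP scalerDr addrACA. Qed.
Fact rep_add_equivariant f g h u :
  f (act h u) + g (act h u) = act h (f u + g u).
Proof. by rewrite linearD !rep_equivariant. Qed.
Definition rep_add f g :=
  @RepHom V W _ (rep_add_linear f g) (rep_add_equivariant f g).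

Fact rep_opp_linear f : linear (fun v => - f v).
Proof. by move=> a u v; rewrite linearP opprD scalerN. Qed.
Fact rep_opp_equivariant f h u : - f (act h u) = act h (- f u).
Proof. by rewrite linearN rep_equivariant. Qed.
Definition rep_opp f :=
  @RepHom V W _ (rep_opp_linear f) (rep_opp_equivariant f).

Fact rep_addA : associative rep_add.
Proof. by move=> f g h; apply: rep_hom_ext => v /=; rewrite addrA. Qed.
Fact rep_addC : commutative rep_add.
Proof. by move=> f g; apply: rep_hom_ext => v /=; rewrite addrC. Qed.
Fact rep_add0 : left_id rep_zero rep_add.
Proof. by move=> f; apply: rep_hom_ext => v /=; rewrite add0r. Qed.
Fact rep_addN : left_inverse rep_zero rep_opp rep_add.
Proof. by move=> f; apply: rep_hom_ext => v /=; rewrite addNr. Qed.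

HB.instance Definition _ :=
  GRing.isZmodule.Build (rep_hom V W) rep_addA rep_addC rep_add0 rep_addN.
End RepHomZmod.

Definition rep_end (V : smooth_rep) : Type := rep_hom V V.

Section RepEnd.
Variable V : smooth_rep.

HB.instance Definition _ := GRing.Zmodule.on (rep_end V).

Fact rep_compA : associative (@rep_comp V V V).
Proof. by move=> f g h; apply: rep_hom_ext. Qed.
Fact rep_comp1f : left_id (rep_id V) (@rep_comp V V V).
Proof. by move=> f; apply: rep_hom_ext. Qed.
Fact rep_compf1 : right_id (rep_id V) (@rep_comp V V V).
Proof. by move=> f; apply: rep_hom_ext. Qed.
Fact rep_compDl : left_distributive (@rep_comp V V V) (@rep_add V V).
Proof. by move=> f g h; apply: rep_hom_ext. Qed.
Fact rep_compDr : right_distributive (@rep_comp V V V) (@rep_add V V).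
Proof. by move=> f g h; apply: rep_hom_ext => v /=; rewrite linearD. Qed.

HB.instance Definition _ := GRing.Zmodule_isPzRing.Build (rep_end V)
  rep_compA rep_comp1f rep_compf1 rep_compDl rep_compDr.
End RepEnd.
End Representations.

Section Induced.
Variables (k : fieldType) (G : topGroupType) (p : nat).
Variable Iopp : open_pro_p_subgroup G p.
Local Notation I := (opp_set Iopp).

Definition support (f : G -> k^o) : set G := [set g | f g != 0].

Definition ind_pred : pred (G -> k^o) := fun f =>
  `[< (forall g i, I i -> f (g * i)%g = f g) /\ compact (closure (support f)) >].

Record ind := Ind { ind_fun :> G -> k^o; _ : ind_fun \in ind_pred }.
HB.instance Definition _ := [isSub for ind_fun].
HB.instance Definition _ := [Choice of ind by <:].

Lemma I_subgroup : subgroup I.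
Proof. by case: (opp_pro_p Iopp) => [[]]. Qed.
Lemma I1 : I 1%g. Proof. by case: I_subgroup. Qed.
Lemma IM x y : I x -> I y -> I (x * y)%g. Proof. by case: I_subgroup => _ + _; apply. Qed.
Lemma IV x : I x -> I x^-1%g. Proof. by case: I_subgroup => _ _; apply. Qed.
Lemma IVE x : I x^-1%g = I x.
Proof. by apply/propext; split=> [/IV|/IV//]; rewrite invgK. Qed.
Lemma I_compact : compact I.
Proof. by case: (opp_pro_p Iopp) => [[]]. Qed.

Lemma open_coset (g : G) : open [set x | I (g^-1 * x)%g].
Proof. exact/open_lmulg/opp_open. Qed.

Lemma I_saturated_closed (A : set G) :
  (forall g i, I i -> A (g * i)%g -> A g) -> closed A.
Proof.
move=> AI; rewrite -[A]setCK; apply: open_closedC.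
have -> : ~` A = \bigcup_(g in ~` A) [set x | I (g^-1 * x)%g].
  apply/seteqP; split=> x; first by move=> Ax; exists x => //=; rewrite mulVg; apply: I1.
  move=> [g /= nAg Igx] Ax; apply: nAg; apply: (AI _ _ Igx).
  by rewrite mulgA mulgV mul1g.
by apply: bigcup_open => g _; apply: open_coset.
Qed.

Lemma ind_closure (f : G -> k^o) :
  (forall g i, I i -> f (g * i)%g = f g) -> closure (support f) = support f.
Proof.
move=> fI; apply/esym/closure_id; apply: I_saturated_closed => g i Ii.
by rewrite /support /= fI.
Qed.

Lemma ind_predP (f : G -> k^o) :
  reflect ((forall g i, I i -> f (g * i)%g = f g) /\ compact (support f))
          (f \in ind_pred).
Proof.
rewrite unfold_in; apply: (iffP (asboolP _)) => -[fI cf]; split=> //.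
  by rewrite -(ind_closure fI).
by rewrite ind_closure.
Qed.

Lemma ind_right (f : ind) g i : I i -> f (g * i)%g = f g.
Proof. by case: f => f /= /ind_predP[fI _]; apply: fI. Qed.

Lemma ind_compact (f : ind) : compact (support f).
Proof. by case: f => f /= /ind_predP[_]. Qed.

Fact ind_submod_closed : submod_closed ind_pred.
Proof.
split=> [|a f f' /ind_predP[fI cf] /ind_predP[fI' cf']]; apply/ind_predP.
  split=> //; have -> : support (0 : G -> k^o) = set0.
    by apply/seteqP; split=> x //=; rewrite /support /= eqxx.
  exact: compact0.
have afI g i : I i -> (a *: f + f') (g * i)%g = (a *: f + f') g.
  by move=> Ii; rewrite /GRing.add /GRing.scale /= fI// fI'.
split=> //; apply: (@subclosed_compact _ _ (support f `|` support f')).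
- by rewrite -(ind_closure afI); apply: closed_closure.
- exact: compactU.
move=> x; rewrite /support /= /GRing.add /GRing.scale /=.
by case: (eqVneq (f x) 0) => [->|]; [rewrite scaler0 add0r; right|left].
Qed.

HB.instance Definition _ :=
  GRing.isSubmodClosed.Build k (G -> k^o) ind_pred ind_submod_closed.
HB.instance Definition _ := [SubChoice_isSubLmodule of ind by <:].

Lemma ind_ext (f f' : ind) : (forall g, f g = f' g) -> f = f'.
Proof. by move=> ff'; apply/val_inj/funext. Qed.

Lemma indDE (f f' : ind) g : (f + f') g = f g + f' g. Proof. by []. Qed.
Lemma indZE a (f : ind) g : (a *: f) g = a * f g. Proof. by []. Qed.
Lemma ind0E g : (0 : ind) g = 0. Proof. by []. Qed.

Fact ind_act_subproof (u : G) (f : ind) : (fun g => f (u^-1 * g)%g) \in ind_pred.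
Proof.
apply/ind_predP; split=> [g i Ii|]; first by rewrite mulgA ind_right.
have -> : support (fun g => f (u^-1 * g)%g) = (fun x => (u * x)%g) @` support f.
  apply/seteqP; split=> [x /= fx|_ [x /= fx <-]].
    by exists (u^-1 * x)%g => //; rewrite mulgA mulgV mul1g.
  by rewrite /support /= mulgA mulVg mul1g.
apply: continuous_compact (@ind_compact f).
by apply: continuous_subspaceT => x; apply: lmulg_continuous.
Qed.

Definition ind_act (u : G) (f : ind) : ind := Ind (ind_act_subproof u f).

Fact charI_subproof : (fun g => (`[< I g >])%:R : k^o) \in ind_pred.
Proof.
apply/ind_predP; split=> [g i Ii|].
  congr (nat_of_bool _)%:R; apply/asbool_equiv_eq; split=> [|/IM]; last exact.
  by move=> /IM /(_ (IV Ii)); rewrite -mulgA mulgV mulg1.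
have -> : support (fun g => (`[< I g >])%:R : k^o) = I; last exact: I_compact.
apply/seteqP; split=> x; rewrite /support /=.
  by case: asboolP => // _; rewrite eqxx.
by move=> Ix; rewrite asboolT// oner_neq0.
Qed.

Definition charI : ind := Ind charI_subproof.

Lemma ind_cover (f : ind) :
  exists s : seq G, forall x, f x != 0 -> exists2 g, g \in s & I (g^-1 * x)%g.
Proof.
(* compact_cover is stated for pointed spaces *)
pose T := HB.pack_for ptopologicalType G (isPointed.Build G 1%g).
have : @cover_compact T (support f) by rewrite -compact_cover; apply: ind_compact.
case/(_ G setT (fun g => [set x | I (g^-1 * x)%g])) => [g _|x _|D _ fD].
- exact: open_coset.
- by exists x => //=; rewrite mulVg; apply: I1.
by exists (finmap.enum_fset D) => x /fD[g /= gD]; exists g.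
Qed.

Fact ind_act_linear u : linear (ind_act u).
Proof. by move=> a f f'; apply: ind_ext. Qed.

Fact ind_act1 f : ind_act 1%g f = f.
Proof. by apply: ind_ext => g /=; rewrite invg1 mul1g. Qed.

Fact ind_actM u v f : ind_act (u * v)%g f = ind_act u (ind_act v f).
Proof. by apply: ind_ext => g /=; rewrite invgM mulgA. Qed.

Lemma charI_translate (u g : G) : ind_act u charI g = (`[< I (u^-1 * g)%g >])%:R.
Proof. by []. Qed.

Lemma ind_act_charI i : I i -> ind_act i charI = charI.
Proof.
move=> Ii; apply: ind_ext => g /=; congr (nat_of_bool _)%:R.
apply/asbool_equiv_eq; split=> [/(IM Ii)|]; last exact/IM/IV.
by rewrite mulgA mulgV mul1g.
Qed.

Lemma ind_span (P : ind -> Prop) :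
  P 0 -> (forall a u f, P f -> P (a *: ind_act u charI + f)) -> forall f, P f.
Proof.
move=> P0 PD f; have [s] := ind_cover f.
elim: s f => [|u s IHs] f fs.
  suff -> : f = 0 by [].
  apply: ind_ext => x; rewrite ind0E; apply/eqP/negPn/negP => /fs[g].
  by rewrite in_nil.
pose f' := f - f u *: ind_act u charI.
have -> : f = f u *: ind_act u charI + f' by rewrite addrC subrK.
apply/PD/IHs => x; rewrite /f' -scaleNr indDE indZE charI_translate.
case: asboolP => [Iux|nIux].
  have -> : f x = f u by rewrite -(ind_right f u Iux) mulgA mulgV mul1g.
  by rewrite mulr1 subrr eqxx.
rewrite mulr0 addr0 => /fs[g]; rewrite inE => /predU1P[->//|]; by exists g.
Qed.

Lemma ind_act_smooth f : open [set u | ind_act u f = f].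
Proof.
have fsub (h : ind) : subgroup [set u | ind_act u h = h].
  split=> [|x y /= xh yh|x /= xh]; first exact: ind_act1.
    by rewrite ind_actM yh xh.
  by rewrite -{1}xh -ind_actM mulVg ind_act1.
elim/ind_span: f => [|a u f openf].
  rewrite (_ : mkset _ = setT); first exact: openT.
  by apply/seteqP; split=> // u _ /=; apply: ind_ext.
have openu : open [set x | I (u^-1 * (x * u))%g].
  have := open_coset u; move/(open_rmulg u); congr open.
apply: (subgroup_open (fsub _) (openI openu openf)); first split=> /=.
- by rewrite mul1g mulVg; apply: I1.
- exact: ind_act1.
move=> x [/= Ix fx]; rewrite ind_act_linear fx -ind_actM.
rewrite (_ : (x * u = u * (u^-1 * (x * u)))%g); last by rewrite mulgA mulgV mul1g.
by rewrite ind_actM ind_act_charI.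
Qed.

Definition X : smooth_rep k G :=
  SmoothRep ind_act_linear ind_act1 ind_actM ind_act_smooth.

Definition charX : X := charI.

Lemma X_span (P : X -> Prop) :
  P 0 -> (forall a u f, P f -> P (a *: act u charX + f)) -> forall f, P f.
Proof. exact: ind_span. Qed.

(* h in H acts on the right of X by x h = h(x), as H is the opposite of
   End_G(X). *)
Definition H : pzRingType := (rep_end X)^c.

Definition ractX (x : X) (h : H) : X := (h : rep_hom X X) x.

Section FObj.
Variable M : lmodType H.

Definition XH : Type := tensor ractX M.
HB.instance Definition _ := GRing.Zmodule.on XH.

Definition XH_scale (a : k) : XH -> XH := tmap ractX (fun x : X => a *: x) id.
Definition XH_act (g : G) : XH -> XH := tmap ractX (@act k G X g) id.

Let linid : linear (@id M). Proof. by []. Qed.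
Let scaleD (a : k) : {morph (fun x : X => a *: x) : x y / x + y}.
Proof. exact: scalerDr. Qed.
Let scaleH (a : k) x r : a *: ractX x r = ractX (a *: x) r.
Proof. by rewrite /ractX linearZ. Qed.
Let actD g : {morph @act k G X g : x y / x + y}. Proof. exact: linearD. Qed.
Let actH g x r : act g (ractX x r) = ractX (act g x) r.
Proof. by rewrite /ractX rep_equivariant. Qed.

Lemma XH_scale_pure a x m : XH_scale a (pure ractX x m) = pure ractX (a *: x) m.
Proof. exact: tmap_pure. Qed.
Lemma XH_act_pure g x m : XH_act g (pure ractX x m) = pure ractX (act g x) m.
Proof. exact: tmap_pure. Qed.

Fact XH_scaleDr : right_distributive XH_scale +%R.
Proof. by move=> a s t; apply: tmapD. Qed.
Fact XH_scale0 a : XH_scale a 0 = 0. Proof. exact: tmap0. Qed.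
Fact XH_scaleA a b v : XH_scale a (XH_scale b v) = XH_scale (a * b) v.
Proof.
elim/tensor_ind: v => [|x m t IHt]; first by rewrite !XH_scale0.
by rewrite !XH_scaleDr IHt !XH_scale_pure scalerA.
Qed.
Fact XH_scale1 : left_id 1 XH_scale.
Proof.
elim/tensor_ind => [|x m t IHt]; first by rewrite XH_scale0.
by rewrite XH_scaleDr IHt XH_scale_pure scale1r.
Qed.
Fact XH_scaleDl v : {morph XH_scale^~ v : a b / a + b}.
Proof.
move=> a b; elim/tensor_ind: v => [|x m t IHt]; first by rewrite !XH_scale0 addr0.
by rewrite !XH_scaleDr IHt !XH_scale_pure scalerDl pureDl addrACA.
Qed.
HB.instance Definition _ := GRing.Zmodule_isLmodule.Build k XH
  XH_scaleA XH_scale1 XH_scaleDr XH_scaleDl.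

Lemma XH_scaleE a x m : a *: (pure ractX x m : XH) = pure ractX (a *: x) m.
Proof. exact: XH_scale_pure. Qed.

Lemma XH_actD g : {morph XH_act g : s t / s + t}.
Proof. by move=> s t; apply: tmapD. Qed.
Lemma XH_act0 g : XH_act g 0 = 0. Proof. exact: tmap0. Qed.

Fact XH_act_linear g : linear (XH_act g).
Proof.
move=> a s t; rewrite XH_actD; congr (_ + _).
elim/tensor_ind: s => [|x m s IHs]; first by rewrite scaler0 XH_act0 scaler0.
rewrite scalerDr XH_actD IHs XH_actD scalerDr; congr (_ + _).
by rewrite XH_scaleE !XH_act_pure linearZ XH_scaleE.
Qed.
Fact XH_act1 v : XH_act 1%g v = v.
Proof.
elim/tensor_ind: v => [|x m t IHt]; first exact: XH_act0.
by rewrite XH_actD IHt XH_act_pure act1.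
Qed.
Fact XH_actM g h v : XH_act (g * h)%g v = XH_act g (XH_act h v).
Proof.
elim/tensor_ind: v => [|x m t IHt]; first by rewrite !XH_act0.
by rewrite !XH_actD IHt !XH_act_pure actM.
Qed.
Fact XH_act_smooth v : open [set g | XH_act g v = v].
Proof.
elim/tensor_ind: v => [|x m t IHt].
  rewrite (_ : mkset _ = setT); first exact: openT.
  by apply/seteqP; split=> // u _ /=; apply: XH_act0.
have fsub (w : XH) : subgroup [set u | XH_act u w = w].
  split=> [|y z /= yw zw|y /= yw]; first exact: XH_act1.
    by rewrite XH_actM zw yw.
  by rewrite -{1}yw -XH_actM mulVg XH_act1.
apply: (subgroup_open (fsub _) (openI (@act_smooth k G X x) IHt)).
  by split=> /=; [exact: ind_act1|apply: XH_act1].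
by move=> g [/= gx gt]; rewrite XH_actD gt XH_act_pure (gx : @act k G X g x = x).
Qed.

Definition F_obj : smooth_rep k G :=
  SmoothRep XH_act_linear XH_act1 XH_actM XH_act_smooth.
End FObj.

Section FMap.
Variables (M N : lmodType H) (f : {linear M -> N}).

Definition F_fun : F_obj M -> F_obj N := tmap ractX id f.

Let flin : linear f. Proof. exact: linearP. Qed.

Lemma F_fun_pure x m : F_fun (pure ractX x m) = pure ractX x (f m).
Proof. by rewrite /F_fun tmap_pure. Qed.
Lemma F_funD : {morph F_fun : s t / s + t}.
Proof. by move=> s t; rewrite /F_fun tmapD. Qed.
Lemma F_fun0 : F_fun 0 = 0. Proof. by rewrite /F_fun tmap0. Qed.

Fact F_fun_linear : linear F_fun.
Proof.
move=> a s t; rewrite F_funD; congr (_ + _).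
elim/tensor_ind: s => [|x m s IHs]; first by rewrite scaler0 F_fun0 scaler0.
rewrite scalerDr F_funD IHs F_funD scalerDr; congr (_ + _).
by rewrite XH_scaleE !F_fun_pure XH_scaleE.
Qed.

Fact F_fun_equivariant g t : F_fun (act g t) = act g (F_fun t).
Proof.
elim/tensor_ind: t => [|x m s IHs]; first by rewrite linear0 !F_fun0 linear0.
rewrite linearD !F_funD IHs linearD; congr (_ + _).
rewrite F_fun_pure; transitivity (F_fun (pure ractX (act g x) m)).
  by congr F_fun; apply: XH_act_pure.
by rewrite F_fun_pure; apply/esym/XH_act_pure.
Qed.

Definition F_map : rep_hom (F_obj M) (F_obj N) :=
  RepHom F_fun_linear F_fun_equivariant.
End FMap.

Definition F : functor (Mod H) (Rep k G).
Proof.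
refine (@Functor (Mod H) (Rep k G) F_obj F_map _ _).
- move=> M; apply: rep_hom_ext => t /=.
  elim/tensor_ind: t => [|x m s IHs]; first exact: F_fun0.
  by rewrite F_funD IHs F_fun_pure.
- move=> M N P g f; apply: rep_hom_ext => t /=.
  elim/tensor_ind: t => [|x m s IHs]; first by rewrite !F_fun0.
  by rewrite !F_funD IHs !F_fun_pure.
Defined.

Definition coset_rep (g : G) : G := xget 1%g [set x | I (g^-1 * x)%g].

Definition coset_reps : set G := [set g | coset_rep g = g].

Lemma coset_repP g : I (g^-1 * coset_rep g)%g.
Proof.
by apply: (@xgetI _ 1%g [set x | I (g^-1 * x)%g] g); rewrite /= mulVg; apply: I1.
Qed.

Lemma coset_rep_eq g h : I (g^-1 * h)%g -> coset_rep g = coset_rep h.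
Proof.
move=> Igh; congr xget; apply/seteqP; split=> x /= Ix.
  rewrite (_ : (h^-1 * x = (g^-1 * h)^-1 * (g^-1 * x))%g); first exact: IM (IV _) _.
  by rewrite invgM invgK -mulgA [(g * _)%g]mulgA mulgV mul1g.
rewrite (_ : (g^-1 * x = (g^-1 * h) * (h^-1 * x))%g); first exact: IM.
by rewrite -mulgA [(h * _)%g]mulgA mulgV mul1g.
Qed.

Lemma coset_repK g : coset_rep (coset_rep g) = coset_rep g.
Proof. exact/esym/coset_rep_eq/coset_repP. Qed.

Section Invariants.
Variable V : smooth_rep k G.

Definition inv_pred : pred V := fun v => `[< forall i, I i -> act i v = v >].

Lemma inv_predP (v : V) :
  reflect (forall i, I i -> act i v = v) (v \in inv_pred).
Proof. by rewrite unfold_in; apply: asboolP. Qed.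

Record invariants := Invariant { inv_val :> V; _ : inv_val \in inv_pred }.
HB.instance Definition _ := [isSub for inv_val].
HB.instance Definition _ := [Choice of invariants by <:].

Fact inv_zmod_closed : zmod_closed inv_pred.
Proof.
split=> [|u v /inv_predP uI /inv_predP vI]; apply/inv_predP => i Ii.
  exact: linear0.
by rewrite linearB /= uI// vI.
Qed.
HB.instance Definition _ := GRing.isZmodClosed.Build V inv_pred inv_zmod_closed.
HB.instance Definition _ := [SubChoice_isSubZmodule of invariants by <:].

Lemma invariantsP (v : invariants) i : I i -> act i (inv_val v) = inv_val v.
Proof. by case: v => v /= /inv_predP; apply. Qed.

Lemma invD (u v : invariants) : inv_val (u + v) = inv_val u + inv_val v.
Proof. by []. Qed.

(* The inverse of the bijection Hom_G(X, V) -> V^I, phi |-> phi charX: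
   the sum over the cosets g I of f(g) g v. *)
Definition frob_fun (v : V) (f : X) : V :=
  \sum_(g \in coset_reps) (f : ind) g *: act g v.

Lemma frob_funE (v : V) (f : ind) (A : set G) :
  (forall g, coset_reps g -> f g != 0 -> A g) ->
  frob_fun v f = \sum_(g \in coset_reps `&` A) f g *: act g v.
Proof.
move=> fA; apply/esym/fsbig_widen => [g []//|g [gR nA] /=].
have [->|fg] := eqVneq (f g) 0; first by rewrite scale0r.
by case: nA; split=> //; apply: fA.
Qed.

Fact frob_linear v : linear (frob_fun v).
Proof.
move=> a f f'; have [s fs] := ind_cover f; have [s' fs'] := ind_cover f'.
pose A := [set` map coset_rep (s ++ s')].
have cov (h : ind) (t : seq G) : {subset t <= s ++ s'} ->
    (forall x, h x != 0 -> exists2 g, g \in t & I (g^-1 * x)%g) ->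
    forall g, coset_reps g -> h g != 0 -> A g.
  move=> ts ht g gR /ht[x xt Ixg]; rewrite /A /= -gR; apply/mapP.
  by exists x; [apply: ts|apply/esym/coset_rep_eq].
have Af : forall g, coset_reps g -> f g != 0 -> A g.
  by apply: (cov f s) => // x xs; rewrite mem_cat xs.
have Af' : forall g, coset_reps g -> f' g != 0 -> A g.
  by apply: (cov f' s') => // x xs; rewrite mem_cat xs orbT.
rewrite (frob_funE v Af) (frob_funE v Af') (@frob_funE v (a *: f + f') A).
  have finA : finite_set (coset_reps `&` A).
    by apply: sub_finite_set (finite_seq (map coset_rep (s ++ s'))) => g [].
  rewrite !fsbig_finite//= scaler_sumr -big_split /=; apply: eq_bigr => g _.
  by rewrite scalerA -scalerDl.
move=> g gR; rewrite indDE indZE.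
have [f0|fg _] := eqVneq (f g) 0; last exact: Af.
by rewrite f0 mulr0 add0r => /(Af' _ gR).
Qed.

Lemma frob_translate (v : invariants) u :
  frob_fun (inv_val v) (act u charX) = act u (inv_val v).
Proof.
rewrite (@frob_funE _ (ind_act u charI) [set coset_rep u]); last first.
  move=> g gR; rewrite charI_translate; case: asboolP => [Iug _|]; last first.
    by rewrite eqxx.
  by rewrite /= -gR; apply/esym/coset_rep_eq.
rewrite (_ : _ `&` _ = [set coset_rep u]).
  rewrite fsbig_set1 charI_translate asboolT ?scale1r; last exact: coset_repP.
  rewrite -{2}(invariantsP v (coset_repP u)) -actM.
  by rewrite mulgA mulgV mul1g.
by apply/seteqP; split=> [g []//|_ ->]; split=> //; apply: coset_repK.
Qed.

Lemma rep_hom_X_ext (phi psi : rep_hom X V) :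
  phi charX = psi charX -> phi = psi.
Proof.
move=> e; apply: rep_hom_ext; elim/X_span => [|a u f IHf].
  by rewrite (linear0 phi) (linear0 psi).
rewrite (rep_linear phi) (rep_linear psi) IHf; congr (_ *: _ + _).
by rewrite (rep_equivariant phi) (rep_equivariant psi) e.
Qed.

Fact frob_equivariant (v : invariants) g f :
  frob_fun (inv_val v) (act g f) = act g (frob_fun (inv_val v) f).
Proof.
have frob0 : frob_fun (inv_val v) 0 = 0.
  by rewrite -(subrr (0 : X)) -scaleN1r addrC frob_linear scaleN1r addNr.
elim/X_span: f => [|a u f IHf]; first by rewrite linear0 frob0 linear0.
rewrite act_linear !frob_linear IHf act_linear; congr (_ *: _ + _).
by rewrite -actM !frob_translate actM.
Qed.

Definition frob (v : invariants) : rep_hom X V :=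
  RepHom (frob_linear (inv_val v)) (frob_equivariant v).

Lemma frob_charX v : frob v charX = inv_val v.
Proof.
by rewrite -[RHS](act1 (inv_val v)) -frob_translate act1.
Qed.

Lemma frob_unique (v : invariants) (phi : rep_hom X V) :
  phi charX = inv_val v -> phi = frob v.
Proof. by move=> e; apply: rep_hom_X_ext; rewrite frob_charX. Qed.

Lemma rep_hom_charX_inv (phi : rep_hom X V) : phi charX \in inv_pred.
Proof.
apply/inv_predP => i Ii; rewrite -(rep_equivariant phi); congr (phi _).
exact: ind_act_charI.
Qed.

(* The H-module structure on V^I transported from Hom_G(X, V), where h in H
   acts by phi |-> phi \o h. *)
Fact inv_scale_subproof (h : H) (v : invariants) :
  rep_comp (frob v) (h : rep_hom X X) charX \in inv_pred.
Proof. exact: rep_hom_charX_inv. Qed.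

Definition inv_scale (h : H) (v : invariants) : invariants :=
  Invariant (inv_scale_subproof h v).

Lemma frob_scale (h : H) (v : invariants) :
  frob (inv_scale h v) = rep_comp (frob v) (h : rep_hom X X).
Proof. exact/esym/frob_unique. Qed.

Fact inv_scaleA g h v : inv_scale g (inv_scale h v) = inv_scale (g * h) v.
Proof.
apply: val_inj.
rewrite -[LHS]/(frob (inv_scale h v) ((g : rep_hom X X) charX)).
by rewrite frob_scale.
Qed.

Fact inv_scale1 : left_id 1 inv_scale.
Proof. by move=> v; apply: val_inj; apply: frob_charX. Qed.

Fact inv_scaleDr : right_distributive inv_scale +%R.
Proof.
move=> h u v; apply: val_inj.
rewrite -[LHS]/(frob (u + v) ((h : rep_hom X X) charX)).
have <- // : frob u + frob v = frob (u + v).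
by apply: frob_unique; rewrite invD -!frob_charX.
Qed.

Fact inv_scaleDl v : {morph inv_scale^~ v : g h / g + h}.
Proof. by move=> g h; apply: val_inj; apply: (linearD (frob v)). Qed.

HB.instance Definition _ := GRing.Zmodule_isLmodule.Build H invariants
  inv_scaleA inv_scale1 inv_scaleDr inv_scaleDl.

Definition U_obj : lmodType H := invariants.
End Invariants.

Section UMap.
Variables (V W : smooth_rep k G) (f : rep_hom V W).

Fact U_fun_subproof (v : U_obj V) : f (inv_val v) \in @inv_pred W.
Proof.
by apply/inv_predP => i Ii; rewrite -rep_equivariant (invariantsP v Ii).
Qed.

Definition U_fun (v : U_obj V) : U_obj W := Invariant (U_fun_subproof v).

Fact U_fun_linear : linear U_fun.
Proof.
move=> h u v; apply: val_inj.
rewrite -[RHS]/(frob (U_fun u) ((h : rep_hom X X) charX) + f (inv_val v)).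
have <- : rep_comp f (frob u) = frob (U_fun u).
  by apply: frob_unique; rewrite -[RHS]/(f (inv_val u)) -frob_charX.
exact: (linearD f).
Qed.

HB.instance Definition _ :=
  GRing.isLinear.Build H (U_obj V) (U_obj W) *:%R U_fun U_fun_linear.

Definition U_map : {linear U_obj V -> U_obj W} := U_fun.
End UMap.

Definition U : functor (Rep k G) (Mod H).
Proof.
refine (@Functor (Rep k G) (Mod H) U_obj U_map _ _).
- by move=> V; apply: linear_ext => v; apply: val_inj.
- by move=> V W Z g f; apply: linear_ext => v; apply: val_inj.
Defined.

Definition I_projective (V : Rep k G) : Prop :=
  exists2 P : Mod H, projective_module P & exists f : hom (F P) V, split_epi f.
End Induced.

(* Main.v *)
Require Import Defs.
From HB Require Import structures.
From mathcomp Require Import all_boot all_order all_algebra.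
From mathcomp Require Import all_classical.
From mathcomp Require Import topology.

Set Implicit Arguments.
Unset Strict Implicit.
Unset Printing Implicit Defensive.

Import Defs GRing.Theory.
Local Open Scope ring_scope.

(** Write eta_M : M -> (X ⊗_H M)^I, m |-> 1_I ⊗ m, for the unit of the adjunction
    and eps_V : X ⊗_H V^I -> V, x ⊗ v |-> f_v(x), for its counit, where
    f_v : X -> V is the G-map sending the characteristic function 1_I to v.
    Everything reduces to one fact: eta_P is an isomorphism when P is a
    projective H-module ([unit_projective_iso]).

    For P = H this is Frobenius reciprocity, U (F H) = X^I = End_G(X) = H; the
    general case is usually deduced by passing to direct sums and direct
    summands.  Here both passages are replaced by a dual basis of P, that is,
    vectors x in P and linear forms phi_x : P -> H with
    m = sum_x phi_x(m) x ([projective_dual_basis]).  Each phi_x induces a G-map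
    psi_x : F P -> X ([contract]), and then t = sum_x psi_x(t) ⊗ x for every t
    in F P ([contract_expansion]).  If t is I-invariant then so is psi_x(t),
    which therefore has the form h_x(1_I) = 1_I h_x for some h_x in H, so that
    t = sum_x 1_I h_x ⊗ x = 1_I ⊗ sum_x h_x x lies in the image of eta_P.  If
    eta_P(m) = 0, applying psi_x gives phi_x(m)(1_I) = 0, hence phi_x(m) = 0
    because 1_I generates X, and so m = 0.

    The rest is formal.  The triangle identity eps_(F P) o F(eta_P) = id
    ([counit_F_unit]) makes eps_(F P) an isomorphism, and therefore also eps_V
    for every retract V of F P ([counit_I_projective_iso]); moreover U V is then
    a retract of U (F P), which is isomorphic to P, and so is projective
    ([U_I_projective]).  Thus eta and eps restrict to natural isomorphisms on
    the two subcategories. *)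

(** * Natural isomorphisms and retracts *)

Lemma nat_iso_sym (C D : category) (K L : functor C D) :
  nat_iso K L -> nat_iso L K.
Proof.
move=> [a [a_iso a_nat]]; pose b x := sval (cid (a_iso x)).
have ab x : compc (b x) (a x) = idc (K x) /\ compc (a x) (b x) = idc (L x).
  exact: svalP (cid (a_iso x)).
exists b; split=> [x|x y f]; first by exists (a x); case: (ab x).
have [ba _] := ab y; have [_ ax] := ab x.
rewrite -[RHS]comp1c -ba -compA [compc (a y) _]compA a_nat.
by rewrite -[compc _ (b x)]compA ax compc1.
Qed.

Lemma fmap_iso (C D : category) (K : functor C D) (a b : C) (f : hom a b) :
  is_iso f -> is_iso (fmap K f).
Proof.
by move=> [g [gf fg]]; exists (fmap K g); rewrite -!fmap_comp gf fg !fmap1.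
Qed.

Lemma is_iso_left_inverse (C : category) (a b : C) (f : hom a b) (g : hom b a) :
  is_iso f -> compc g f = idc a -> is_iso g.
Proof.
move=> [h [hf fh]] gf; exists f; split=> //.
suff -> : g = h by [].
by rewrite -[g]compc1 -fh compA gf comp1c.
Qed.

(** By naturality the arrow [e b] is a retract of the arrow [e a], and a retract
    of an isomorphism is an isomorphism. *)
Lemma nat_transf_iso_retract (C D : category) (K L : functor C D)
    (e : forall x, hom (K x) (L x)) (a b : C) (f : hom a b) :
  (forall x y (u : hom x y), compc (e y) (fmap K u) = compc (fmap L u) (e x)) ->
  split_epi f -> is_iso (e a) -> is_iso (e b).
Proof.
move=> e_nat [s fs] [g [ge eg]].
exists (compc (fmap K f) (compc g (fmap L s))); split.
  rewrite -!compA -e_nat [compc g _]compA ge comp1c -fmap_comp fs.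
  exact: fmap1.
rewrite compA e_nat -compA [compc (e a) _]compA eg comp1c -fmap_comp fs.
exact: fmap1.
Qed.

Lemma projective_retract (R : pzRingType) (P Q : lmodType R)
    (r : {linear P -> Q}) (s : {linear Q -> P}) :
  cancel s r -> projective_module P -> projective_module Q.
Proof.
move=> sK projP M N f g f_surj.
have [h fh] := projP M N f (g \o r : {linear P -> N}) f_surj.
exists (h \o s : {linear Q -> M}) => x.
by rewrite /= fh /= sK.
Qed.

Lemma bijective_is_iso (R : pzRingType) (M N : lmodType R) (f : {linear M -> N}) :
  injective f -> (forall y, exists x, f x = y) -> @is_iso (Mod R) M N f.
Proof.
move=> f_inj /choice[g fg].
have g_linear : linear g.
  by move=> a u v; apply: f_inj; rewrite linearP !fg.
pose G := GRing.isLinear.Build R N M *:%R g g_linear.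
pose g' : {linear N -> M} := HB.pack g G.
exists g'; split; apply: linear_ext => x /=; last exact: fg.
by apply: f_inj; rewrite fg.
Qed.

(** * Dual bases of projective modules *)

Section FreeModule.
Variables (R : pzRingType) (T : choiceType).

(** The values are taken in [R^o], and not in [R], so that functions form a left
    module. *)
Definition finsupp_pred : pred (T -> R^o) :=
  fun f => `[< exists s : seq T, forall x, x \notin s -> f x = 0 >].

Record free_module :=
  FreeModule { coeff :> T -> R^o; _ : coeff \in finsupp_pred }.
HB.instance Definition _ := [isSub for coeff].
HB.instance Definition _ := [Choice of free_module by <:].

Fact finsupp_submod_closed : submod_closed finsupp_pred.
Proof.
split=> [|a f g]; first by apply/asboolP; exists [::].
move=> /asboolP[s fs] /asboolP[t gt]; apply/asboolP; exists (s ++ t) => x.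
rewrite mem_cat negb_or => /andP[/fs fx /gt gx].
by rewrite /GRing.add /GRing.scale /= fx gx scaler0 addr0.
Qed.
HB.instance Definition _ :=
  GRing.isSubmodClosed.Build R (T -> R^o) finsupp_pred finsupp_submod_closed.
HB.instance Definition _ := [SubChoice_isSubLmodule of free_module by <:].

Lemma coeff_finsupp (f : free_module) :
  exists s : seq T, forall x, x \notin s -> f x = 0.
Proof. by case: f => f /= /asboolP. Qed.

Definition coefficient (x : T) (f : free_module) : R^o := f x.
Fact coefficient_linear x : linear (coefficient x). Proof. by []. Qed.
HB.instance Definition _ x := GRing.isLinear.Build R free_module R^o *:%R
  (coefficient x) (coefficient_linear x).

Fact basis_subproof (x : T) : (fun y => (y == x)%:R : R^o) \in finsupp_pred.
Proof.
by apply/asboolP; exists [:: x] => y; rewrite inE => /negPf->.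
Qed.
Definition basis (x : T) : free_module := FreeModule (basis_subproof x).
End FreeModule.

(** The free module on the elements of [M] maps onto [M]; a section of this
    surjection is what a projective module offers. *)
Section Total.
Variables (R : pzRingType) (M : lmodType R).

Definition total (f : free_module R M) : M :=
  \sum_(x \in setT) (f x : R) *: (x : M).

Lemma totalE (f : free_module R M) (s : seq M) :
  uniq s -> (forall x, x \notin s -> f x = 0) ->
  total f = \sum_(x <- s) (f x : R) *: (x : M).
Proof.
move=> s_uniq fs; rewrite /total (fsbigE s) //.
  by apply: eq_bigl => x; rewrite in_setT.
by move=> x _ /fs ->; rewrite scale0r.
Qed.

Fact total_linear : linear total.
Proof.
move=> a f g; have [s fs] := coeff_finsupp f; have [t gt] := coeff_finsupp g.
pose r := undup (s ++ t); have r_uniq : uniq r := undup_uniq _.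
have fr x : x \notin r -> f x = 0.
  by rewrite mem_undup mem_cat negb_or => /andP[/fs].
have gr x : x \notin r -> g x = 0.
  by rewrite mem_undup mem_cat negb_or => /andP[_ /gt].
have fgE x : (a *: f + g) x = a * f x + g x by [].
rewrite (totalE r_uniq fr) (totalE r_uniq gr) (@totalE _ r) //; last first.
  by move=> x xr; rewrite fgE fr// gr// mulr0 addr0.
rewrite scaler_sumr -big_split; apply: eq_bigr => x _.
by rewrite fgE scalerDl scalerA.
Qed.
HB.instance Definition _ :=
  GRing.isLinear.Build R (free_module R M) M *:%R total total_linear.

Lemma total_basis (x : M) : total (basis R x) = x.
Proof.
rewrite (@totalE _ [:: x]) //; first by rewrite big_seq1 /= eqxx scale1r.
by move=> y; rewrite inE => /= /negPf->.
Qed.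
End Total.

(** The family of vectors is the identity family of [P].  For each [m] only
    finitely many coordinates [phi x m] should be nonzero; quantifying over a
    list of vectors gives one finite set of indices that serves them all, as is
    needed for the finitely many vectors which occur in a tensor. *)
Definition dual_basis (R : pzRingType) (P : lmodType R)
    (phi : P -> {linear P -> R^o}) : Prop :=
  forall ms : seq P, exists s : seq P,
    forall m, m \in ms -> m = \sum_(x <- s) (phi x m : R) *: x.

(** The coordinates of a section of the surjection from the free module. *)
Lemma projective_dual_basis (R : pzRingType) (P : lmodType R) :
  projective_module P ->
  exists phi : P -> {linear P -> R^o}, dual_basis phi.
Proof.
move=> projP; have [|h hK] := projP _ _ (@total R P) (idfun : {linear P -> P}).
  by move=> x; exists (basis R x); apply: total_basis.
exists (fun x => @coefficient R P x \o h : {linear P -> R^o}) => ms.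
have [s hs] : exists s : seq P,
    forall m x, m \in ms -> x \notin s -> h m x = 0.
  elim: ms => [|m ms [s IHs]]; first by exists [::].
  have [t ht] := coeff_finsupp (h m); exists (t ++ s) => m' x.
  rewrite inE mem_cat negb_or => /predU1P[->|m'ms] /andP[xt xs].
    exact: ht.
  exact: IHs.
exists (undup s) => m mms.
transitivity (total (h m)); first exact/esym/hK.
rewrite (totalE (undup_uniq s)) // => x.
by rewrite mem_undup; apply: hs.
Qed.

(** * The adjunction between F and U *)

Section TensorSums.
Variables (R : pzRingType) (A : zmodType) (ract : A -> R -> A).
Variables (M : lmodType R) (J : Type) (r : seq J).

Lemma pure_suml (f : J -> A) (m : M) :
  pure ract (\sum_(j <- r) f j) m = \sum_(j <- r) pure ract (f j) m.
Proof.
by apply: (big_morph (fun a => pure ract a m)) => [a b|];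
  [apply: pureDl | apply: pure0l].
Qed.

Lemma pure_sumr (a : A) (f : J -> M) :
  pure ract a (\sum_(j <- r) f j) = \sum_(j <- r) pure ract a (f j).
Proof.
by apply: (big_morph (pure ract a)) => [m n|];
  [apply: pureDr | apply: pure0r].
Qed.
End TensorSums.

Section Adjunction.
Variables (k : fieldType) (G : topGroupType) (p : nat).
Variable I : open_pro_p_subgroup G p.
Local Notation X := (X k I).
Local Notation H := (H k I).
Local Notation charX := (charX k I).
Local Notation ractX := (@ractX k G p I).
Local Notation F := (F k I).
Local Notation U := (U k I).

Lemma F_ext (M : lmodType H) (V : smooth_rep k G) (f g : rep_hom (F M) V) :
  (forall x m, f (pure ractX x m) = g (pure ractX x m)) -> f = g.
Proof.
move=> fg; apply: rep_hom_ext; elim/tensor_ind => [|x m t IHt].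
  by rewrite (linear0 f) (linear0 g).
by rewrite (linearD f) (linearD g); congr (_ + _); [apply: fg|apply: IHt].
Qed.

Section Unit.
Variable M : lmodType H.

Fact unit_subproof (m : M) : pure ractX charX m \in @inv_pred k G p I (F M).
Proof.
apply/inv_predP => i Ii; rewrite [LHS]XH_act_pure.
by congr pure; apply: ind_act_charI.
Qed.
Definition unit_fun (m : M) : U (F M) := Invariant (unit_subproof m).

Fact pure_linear (m : M) : linear (fun x : X => pure ractX x m : F M).
Proof. by move=> a x y; rewrite pureDl -XH_scaleE. Qed.
Fact pure_equivariant (m : M) g (x : X) :
  (pure ractX (act g x) m : F M) = act g (pure ractX x m : F M).
Proof. exact/esym/XH_act_pure. Qed.
(** Multiplication by [m], as the G-map X -> F M attached by Frobenius
    reciprocity to the invariant vector 1_I ⊗ m. *)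
Definition pure_hom (m : M) : rep_hom X (F M) :=
  RepHom (pure_linear m) (pure_equivariant m).

Lemma frob_unit (m : M) : frob (unit_fun m) = pure_hom m.
Proof. exact/esym/frob_unique. Qed.

Fact unit_linear : linear unit_fun.
Proof.
move=> h m n; apply: val_inj.
rewrite -[LHS]/(pure ractX charX (h *: m + n)) pureDr -pure_bal.
rewrite -[RHS]/(frob (unit_fun m) ((h : rep_hom X X) charX) +
  pure ractX charX n).
by rewrite frob_unit.
Qed.
HB.instance Definition _ :=
  GRing.isLinear.Build H M (U (F M)) *:%R unit_fun unit_linear.
Definition unit_map : @hom (Mod H) M (U (F M)) :=
  (unit_fun : {linear M -> U (F M)}).
End Unit.

Lemma unit_natural (M N : Mod H) (f : hom M N) :
  compc (unit_map N) f = compc (fmap U (fmap F f)) (unit_map M).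
Proof.
apply: linear_ext => m; apply: val_inj.
exact/esym/F_fun_pure.
Qed.

Section Counit.
Variable V : smooth_rep k G.

Definition counit_fun : F (U V) -> V :=
  tlift (fun (x : X) (v : U V) => frob v x).

Fact counit_balanced :
  balanced ractX (fun (x : X) (v : U V) => frob v x).
Proof.
split=> [x y v|x u v|x h v]; first exact: (linearD (frob v)).
  have <- // : frob u + frob v = frob (u + v).
  by apply: frob_unique; rewrite invD -!frob_charX.
by rewrite -[RHS]/(frob (inv_scale h v) x) frob_scale.
Qed.

Lemma counit_pure x v : counit_fun (pure ractX x v) = frob v x.
Proof. exact: (tlift_pure counit_balanced). Qed.
Lemma counitD : {morph counit_fun : s t / s + t}.
Proof. exact: (tliftD counit_balanced). Qed.
Lemma counit0 : counit_fun 0 = 0.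
Proof. exact: (tlift0 counit_balanced). Qed.

Fact counit_linear : linear counit_fun.
Proof.
move=> a s t; rewrite counitD; congr (_ + _).
elim/tensor_ind: s => [|x v s IHs]; first by rewrite scaler0 counit0 scaler0.
rewrite scalerDr !counitD IHs scalerDr; congr (_ + _).
by rewrite XH_scaleE !counit_pure (linearZ_LR (frob v)).
Qed.

Fact counit_equivariant g t : counit_fun (act g t) = act g (counit_fun t).
Proof.
elim/tensor_ind: t => [|x v t IHt]; first by rewrite linear0 counit0 linear0.
rewrite linearD !counitD IHt linearD; congr (_ + _).
rewrite counit_pure; transitivity (counit_fun (pure ractX (act g x) v)).
  by congr counit_fun; apply: XH_act_pure.
by rewrite counit_pure; apply: (rep_equivariant (frob v)).
Qed.

Definition counit : rep_hom (F (U V)) V :=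
  RepHom counit_linear counit_equivariant.
End Counit.

Lemma frob_comp (V W : smooth_rep k G) (f : rep_hom V W) (v : U V) :
  frob (U_map I f v) = rep_comp f (frob v).
Proof.
by apply/esym/frob_unique; rewrite -[RHS]/(f (inv_val v)) -frob_charX.
Qed.

(** Since f o f_v = f_(f v) by uniqueness, both sides send x ⊗ v to f (f_v x). *)
Lemma counit_natural (V W : Rep k G) (f : hom V W) :
  compc (counit W : @hom (Rep k G) (F (U W)) W) (fmap F (fmap U f)) =
  compc f (counit V : @hom (Rep k G) (F (U V)) V).
Proof.
apply: F_ext => x v.
rewrite -[LHS]/(counit W (F_fun (U_map I f) (pure ractX x v))) F_fun_pure.
rewrite -[RHS]/(f (counit V (pure ractX x v))).
by rewrite [counit W _]counit_pure [counit V _]counit_pure frob_comp.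
Qed.

(** One triangle identity: the G-map X -> F M attached to 1_I ⊗ m sends x to
    x ⊗ m. *)
Lemma counit_F_unit (M : Mod H) :
  compc (counit (F M) : @hom (Rep k G) (F (U (F M))) (F M))
    (fmap F (unit_map M)) = idc (F M).
Proof.
apply: F_ext => x m.
rewrite -[LHS]/(counit (F M) (F_fun (unit_map M) (pure ractX x m))) F_fun_pure.
by rewrite [LHS]counit_pure frob_unit.
Qed.

(** * The unit at a projective module *)

Fact evX_subproof (h : H) : (h : rep_hom X X) charX \in @inv_pred k G p I X.
Proof. exact: rep_hom_charX_inv. Qed.
(** Frobenius reciprocity for V = X, read as an isomorphism of left H-modules
    from H = End_G(X)^op to X^I; its inverse is [frob]. *)
Definition evX_fun (h : H^o) : U X := Invariant (evX_subproof h).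

Lemma frob_evX (h : H) : frob (evX_fun h) = h.
Proof. exact/esym/frob_unique. Qed.

Fact evX_linear : linear evX_fun.
Proof.
move=> a g h; apply: val_inj.
rewrite -[RHS]/(frob (evX_fun g) ((a : rep_hom X X) charX) +
  inv_val (evX_fun h)).
by rewrite frob_evX.
Qed.
HB.instance Definition _ :=
  GRing.isLinear.Build H H^o (U X) *:%R evX_fun evX_linear.
Definition evX : {linear H^o -> U X} := evX_fun.

(** The G-map X ⊗ M -> X adjoint to M -> H = U X. *)
Definition contract (M : lmodType H) (phi : {linear M -> H^o}) :
    rep_hom (F M) X :=
  rep_comp (counit X) (F_map (evX \o phi)).

Lemma contract_pure (M : lmodType H) (phi : {linear M -> H^o}) x m :
  contract phi (pure ractX x m) = ractX x (phi m).
Proof.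
rewrite -[LHS]/(counit X (F_fun (evX \o phi) (pure ractX x m))) F_fun_pure.
by rewrite [LHS]counit_pure frob_evX.
Qed.

(** For a pure tensor x ⊗ m, expand m and move its coordinates across the tensor
    sign; a single index list [s] for all the summands of [t] makes the two
    sums interchangeable. *)
Lemma contract_expansion (P : lmodType H) (phi : P -> {linear P -> H^o}) :
  dual_basis phi ->
  forall t : F P, exists s : seq P,
    t = \sum_(x <- s) pure ractX (contract (phi x) t) x.
Proof.
move=> phiP t; have [s sP] := phiP [seq z.2 | z <- repr (t : tensor ractX P)].
exists s.
have tE : t = \sum_(z <- repr (t : tensor ractX P)) pure ractX z.1 z.2.
  by rewrite -tclass_sum tclass_repr.
rewrite {1}tE (eq_big_seq (fun z =>
  \sum_(x <- s) pure ractX (ractX z.1 (phi x z.2)) x)); last first.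
  move=> z zt; rewrite {1}(sP z.2) ?map_f // pure_sumr.
  by apply: eq_bigr => x _; rewrite pure_bal.
rewrite exchange_big; apply: eq_bigr => x _.
have -> : contract (phi x) t =
    \sum_(z <- repr (t : tensor ractX P)) ractX z.1 (phi x z.2).
  rewrite {1}tE; transitivity (\sum_(z <- repr (t : tensor ractX P))
    contract (phi x) (pure ractX z.1 z.2)); first exact: linear_sum.
  by apply: eq_bigr => z _; apply: contract_pure.
by rewrite pure_suml.
Qed.

(** The coordinates of [m] can be read off from 1_I ⊗ m: contracting it gives
    [phi x m] applied to 1_I, and 1_I generates X. *)
Lemma unit_injective (P : Mod H) (phi : P -> {linear P -> H^o}) :
  dual_basis phi -> injective (@unit_fun P).
Proof.
move=> phiP; apply: raddf_inj => m /(congr1 (@inv_val _ _ _ _ _)) um0.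
have [s sP] := phiP [:: m]; rewrite (sP m) ?mem_head //.
apply: big1 => x _; suff -> : phi x m = 0 by rewrite scale0r.
apply: rep_hom_X_ext; rewrite -[LHS]/(ractX charX (phi x m)) -contract_pure.
by rewrite [pure _ _ _]um0; apply: (linear0 (contract (phi x))).
Qed.

(** G-maps preserve invariants, so the coefficients of the expansion of an
    invariant [t] lie in X^I, that is, in 1_I H, and can be moved to the right of
    the tensor sign. *)
Lemma unit_surjective (P : Mod H) (phi : P -> {linear P -> H^o}) :
  dual_basis phi -> forall t : U (F P), exists m : P, unit_fun m = t.
Proof.
move=> phiP [t tI]; have [s tE] := contract_expansion phiP t.
pose h x : H := frob (U_map I (contract (phi x)) (Invariant tI)).
exists (\sum_(x <- s) h x *: x); apply: val_inj.
rewrite -[LHS]/(pure ractX charX (\sum_(x <- s) h x *: x)) pure_sumr.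
rewrite [RHS]/= tE; apply: eq_bigr => x _.
by rewrite -pure_bal /ractX frob_charX.
Qed.

Lemma unit_projective_iso (P : Mod H) :
  projective_module P -> is_iso (unit_map P).
Proof.
move=> /projective_dual_basis[phi phiP]; apply: bijective_is_iso.
  exact: unit_injective phiP.
exact: unit_surjective phiP.
Qed.

(** * The equivalence *)

Lemma F_projective (P : Mod H) : projective_module P -> I_projective I (F P).
Proof.
move=> projP; exists P => //; exists (idc (F P)); exists (idc (F P)).
exact: comp1c.
Qed.

(** At V = F P the triangle identity exhibits the counit as a left inverse of the
    isomorphism F(eta_P); this passes to retracts of F P. *)
Lemma counit_I_projective_iso (V : Rep k G) :
  I_projective I V -> is_iso (counit V : @hom (Rep k G) (F (U V)) V).
Proof.
move=> [P projP [f f_split]].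
apply: (@nat_transf_iso_retract _ _ (comp_functor F U) (id_functor (Rep k G))
  counit _ _ f counit_natural f_split).
exact: is_iso_left_inverse (fmap_iso F (unit_projective_iso projP))
  (counit_F_unit P).
Qed.

(** U V is a retract of U (F P), and U (F P) is isomorphic to P. *)
Lemma U_I_projective (V : Rep k G) :
  I_projective I V -> projective_module (U V).
Proof.
move=> [P projP [f [s fs]]].
apply: (@projective_retract _ (U (F P)) (U V) (fmap U f) (fmap U s)).
  move=> v; apply: val_inj.
  exact: (congr1 (fun q : rep_hom V V => q (inv_val v)) fs).
have [g [_ ug]] := unit_projective_iso projP.
apply: (projective_retract (r := unit_map P) (s := g) _ projP) => t.
exact: (congr1 (fun q : {linear U (F P) -> U (F P)} => q t) ug).
Qed.
End Adjunction.

Theorem corollary2p9 (k : fieldType) (p : nat) (pchar_k : p \in [pchar k])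
    (G : topGroupType) (I : open_pro_p_subgroup G p) :
  exists (F_proj : forall P : Mod (H k I),
            projective_module P -> I_projective I (F k I P))
         (U_proj : forall V : Rep k G,
            I_projective I V -> projective_module (U k I V)),
    inverse_equivalences (restrict_functor F_proj) (restrict_functor U_proj).
Proof.
exists (@F_projective k G p I), (@U_I_projective k G p I); split.
  apply: nat_iso_sym; exists (fun P => unit_map (sval P)); split.
    by move=> [P projP]; apply: unit_projective_iso.
  by move=> P Q f; apply: unit_natural.
exists (fun V => counit I (sval V)); split.
  by move=> [V projV]; apply: counit_I_projective_iso.
by move=> V W f; apply: counit_natural.
Qed.
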